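(* Let $A\in\mathcal{M}_3(\mathbb{C})$ be a matrix having three pairwise distinct eigenvalues. Then the equation $(XA-AX)^2=X$ admits non-zero solutions $X\in\mathcal{M}_3(\mathbb{C})$.
   Context: $\mathcal{M}_3(\mathbb{C})$ is the set of complex $3\times3$ matrices. *)

(* Defs.v *)
From mathcomp Require Import all_boot all_order all_algebra.
From mathcomp Require Import complex.
From mathcomp Require Import reals.
(* For [R : realType], the field [R[i]] is the field of complex
   numbers. *)
Set Implicit Arguments.
Unset Strict Implicit.
Unset Printing Implicit Defensive.

(* Main.v *)
Require Import Defs.
From mathcomp Require Import all_boot all_order all_algebra.
From mathcomp Require Import ring.
From mathcomp Require Import complex.
From mathcomp Require Import reals.
Import GRing.Theory Num.Theory.
Local Open Scope ring_scope.
Local Open Scope complex_scope.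

(** A rank-one matrix [X = u v] (column times row) satisfies
    [(X A - A X)^2 = X] as soon as [v u = 0], [v A u = 0] and [v A^2 u = -1]:
    all other terms in the expansion of the square vanish.  Since [A] has
    distinct eigenvalues [a], [b], [c], it has linearly independent row
    eigenvectors [wa], [wb], [wc], hence there is a column [u] with
    [wa u = wb u = wc u = 1].  Looking for [v = p wa + q wb + r wc], the three
    conditions become the Vandermonde system
    [p + q + r = 0], [p a + q b + r c = 0], [p a^2 + q b^2 + r c^2 = -1],
    which is solvable because [a], [b], [c] are distinct. *)

Lemma rank_one_solution (F : comNzRingType) (n : nat) (A : 'M[F]_n.+1)
    (u : 'cV[F]_n.+1) (v : 'rV[F]_n.+1) :
    v *m u = 0 -> v *m A *m u = 0 -> v *m A *m A *m u = (- 1)%:M ->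
  (u *m v * A - A * (u *m v)) ^+ 2 = u *m v.
Proof.
move=> vu vAu vAAu.
have rank1M (x : 'cV[F]_n.+1) (y : 'rV[F]_n.+1) (z : 'cV_n.+1) (t : 'rV_n.+1) :
  (x *m y) *m (z *m t) = x *m (y *m z) *m t by rewrite !mulmxA.
rewrite expr2 -!mulmxE -(mulmxA u) (mulmxA A) mulmxBl !mulmxBr !rank1M.
rewrite (mulmxA v A u) (mulmxA (v *m A) A u) vu vAu vAAu.
by rewrite !mulmx0 !mul0mx mul_mx_scalar scaleN1r mulNmx !sub0r !opprK addr0.
Qed.

(** Here [u v] is non-zero because the trace of [u v A^2] is [v A^2 u = -1]. *)
Lemma rank_one_neq0 (F : comNzRingType) (n : nat) (A : 'M[F]_n)
    (u : 'cV[F]_n) (v : 'rV[F]_n) :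
  v *m A *m A *m u = (- 1)%:M -> u *m v != 0.
Proof.
move=> vAAu; apply/eqP => uv0; have /eqP := congr1 mxtrace vAAu.
rewrite mxtrace_mulC !mulmxA uv0 !mul0mx mxtrace0 mxtrace_scalar mulr1n.
by rewrite eq_sym oppr_eq0 oner_eq0.
Qed.

(** Row eigenvectors for pairwise distinct eigenvalues are linearly independent,
    because the sum of the eigenspaces is direct. *)
Lemma eigenvectors_row_free (F : fieldType) (m n : nat) (A : 'M[F]_n)
    (d : 'I_m -> F) (W : 'M[F]_(m, n)) :
    injective d -> (forall i, row i W *m A = d i *: row i W) ->
    (forall i, row i W != 0) ->
  row_free W.
Proof.
move=> inj_d eigW nzW; apply: inj_row_free => x xW0.
have /mxdirect_sumsP dx : mxdirect (\sum_(i | predT i) eigenspace A (d i)).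
  by apply: mxdirect_sum_eigenspace => i j _ _; apply: inj_d.
apply/rowP=> i; rewrite mxE; apply/eqP.
have wE j : (x 0 j *: row j W <= eigenspace A (d j))%MS.
  by apply: scalemx_sub; apply/eigenspaceP.
have : (x 0 i *: row i W <= eigenspace A (d i) :&:
          \sum_(j | j != i) eigenspace A (d j))%MS.
  rewrite sub_capmx wE /=.
  have -> : x 0 i *: row i W = - \sum_(j | j != i) x 0 j *: row j W.
    by move/eqP: xW0; rewrite mulmx_sum_row (bigD1 i) //= addr_eq0 => /eqP.
  by rewrite eqmx_opp; apply: summx_sub_sums => j _; apply: wE.
by rewrite dx // submx0 scaler_eq0 (negbTE (nzW i)) orbF.
Qed.

(** Dual vector to three row eigenvectors: it exists because they form a basis,
    that is, because the matrix stacking them is invertible. *)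
Lemma eigenvectors3_dual (F : fieldType) (A : 'M[F]_3) (a b c : F)
    (wa wb wc : 'rV[F]_3) :
    a != b -> a != c -> b != c ->
    wa *m A = a *: wa -> wb *m A = b *: wb -> wc *m A = c *: wc ->
    wa != 0 -> wb != 0 -> wc != 0 ->
  exists u : 'cV[F]_3, [/\ wa *m u = 1%:M, wb *m u = 1%:M & wc *m u = 1%:M].
Proof.
move=> ab ac bc eiga eigb eigc wa0 wb0 wc0.
pose d (i : 'I_3) := [:: a; b; c]`_i.
pose W : 'M[F]_3 := \matrix_(i < 3) [:: wa; wb; wc]`_i.
have inj_d : injective d.
  have abc : uniq [:: a; b; c] by rewrite /= !inE negb_or ab ac bc.
  by move=> i j /eqP; rewrite nth_uniq // => /eqP /val_inj.
have Wunit : W \in unitmx.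
  rewrite -row_free_unit; apply: (@eigenvectors_row_free _ _ _ A d) => //.
    by case=> [[|[|[|//]]] ?]; rewrite rowK.
  by case=> [[|[|[|//]]] ?]; rewrite rowK.
exists (invmx W *m const_mx 1).
have Wu i : row i W *m (invmx W *m const_mx 1) = 1%:M.
  rewrite -row_mul mulKVmx //.
  by apply/matrixP=> j k; rewrite !mxE !ord1.
by split; [have := Wu 0 | have := Wu 1 | have := Wu (inord 2)];
   rewrite rowK ?inordK.
Qed.

Lemma vandermonde3_solution (F : fieldType) (a b c : F) :
    a != b -> a != c -> b != c ->
  exists p q r : F, [/\ p + q + r = 0, p * a + q * b + r * c = 0 &
    p * a * a + q * b * b + r * c * c = - 1].
Proof.
rewrite -!(subr_eq0 a) -(subr_eq0 b) => ab ac bc.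
(* Opposites of the Lagrange weights: the sum of f(x) / prod_(y <> x) (x - y)
   over the nodes is the coefficient of X^2 in f, for f of degree at most 2. *)
exists (- ((a - b) * (a - c))^-1), ((a - b) * (b - c))^-1,
  (- ((a - c) * (b - c))^-1).
by split; field; rewrite ab ac bc.
Qed.

Theorem proposition6 (R : realType) (A : 'M[R[i]]_3)
    (hA : exists a b c : R[i],
        [/\ a != b, a != c & b != c] /\
        [/\ eigenvalue A a, eigenvalue A b & eigenvalue A c]) :
  exists X : 'M[R[i]]_3, X != 0 /\ (X * A - A * X) ^+ 2 = X.
Proof.
case: hA => a [b [c [[ab ac bc] []]]].
move=> /eigenvalueP[wa eiga wa0] /eigenvalueP[wb eigb wb0].
move=> /eigenvalueP[wc eigc wc0].
have [u [ua ub uc]] := eigenvectors3_dual _ A a b c wa wb wc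
  ab ac bc eiga eigb eigc wa0 wb0 wc0.
have [p [q [r [e0 e1 e2]]]] := vandermonde3_solution _ a b c ab ac bc.
(* Applying A to a combination of the eigenvectors multiplies each coefficient
   by its eigenvalue, and multiplying by u sums the coefficients. *)
pose comb (x y z : R[i]) := x *: wa + y *: wb + z *: wc.
have combA x y z : comb x y z *m A = comb (x * a) (y * b) (z * c).
  by rewrite !mulmxDl -!scalemxAl eiga eigb eigc !scalerA.
have combu x y z : comb x y z *m u = (x + y + z)%:M.
  by rewrite !mulmxDl -!scalemxAl ua ub uc !scale_scalar_mx !mulr1 -!raddfD.
have vAAu : comb p q r *m A *m A *m u = (- 1)%:M by rewrite !combA combu e2.
exists (u *m comb p q r); split; first exact: rank_one_neq0 vAAu.
apply: rank_one_solution => //; first by rewrite combu e0 raddf0.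
by rewrite combA combu e1 raddf0.
Qed.
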